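(* For every integer $r\geq 0$ one has $\psi_r=(-1)^{r+1}\rho_r$, where $\rho_r$ and $\psi_r$ are the coefficients of the asymptotic expansions $\theta_n\sim\sum_{r\ge 0}\rho_r n^{-r}$ and $\Psi_n\sim\sum_{r\ge 0}\psi_r n^{-r}$ as $n\to\infty$ (through positive integers).
   Context: For a positive integer $n$, the real number $\theta_n$ is defined by $$1+\frac{n}{1!}+\frac{n^2}{2!}+\cdots+\frac{n^{n-1}}{(n-1)!}+\frac{n^n}{n!}\theta_n=\frac{e^n}{2},$$ and the real number $\Psi_n$ is defined by $$1+\frac{1!}{n}+\frac{2!}{n^2}+\cdots+\frac{(n-1)!}{n^{n-1}}+\frac{n!}{n^n}\Psi_n=\frac{n\,\mathrm{Ei}(n)}{e^n},$$ where $\mathrm{Ei}$ is the exponential integral (for $x>0$, $\mathrm{Ei}(x)=\mathrm{p.v.}\int_{-\infty}^x \frac{e^t}{t}\,dt$). It is known that $\theta_n$ and $\Psi_n$ have asymptotic expansions in powers of $1/n$: there are unique real sequences $(\rho_r)_{r\ge0}$, $(\psi_r)_{r\ge0}$ such that for every $R\ge 1$, $\theta_n=\sum_{r=0}^{R-1}\rho_r n^{-r}+O(n^{-R})$ and $\Psi_n=\sum_{r=0}^{R-1}\psi_r n^{-r}+O(n^{-R})$ as $n\to\infty$. *)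

(* Defs.v *)
From Stdlib Require Import Reals Factorial.
From Coquelicot Require Import Coquelicot.
Open Scope R_scope.

(* The integral over (-oo, -eps] and [eps, x]; for 0 < eps < x this is the
   integral of exp t / t over (-oo, x] with a symmetric gap around 0. *)
Definition Ei_cut (x eps : R) : R :=
  RInt_gen (fun t => exp t / t) (Rbar_locally m_infty) (at_point (- eps))
  + RInt (fun t => exp t / t) eps x.

(* Principal value, meaningful for 0 < x: the unique limit of [Ei_cut x eps]
   as eps tends to 0 from the right. *)
Definition Ei (x : R) : R :=
  iota (fun l : R => filterlim (Ei_cut x) (at_right 0) (locally l)).

(* Both equations are meant for 1 <= n; [sum_f_R0 f (n - 1)] is then the sum of
   the n terms f 0, ..., f (n - 1). *)
Definition is_theta (n : nat) (t : R) : Prop :=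
  sum_f_R0 (fun k => INR n ^ k / INR (fact k)) (n - 1)
  + INR n ^ n / INR (fact n) * t
  = exp (INR n) / 2.

Definition is_Psi (n : nat) (p : R) : Prop :=
  sum_f_R0 (fun k => INR (fact k) / INR n ^ k) (n - 1)
  + INR (fact n) / INR n ^ n * p
  = INR n * Ei (INR n) / exp (INR n).

(* u_n ~ sum_r a_r n^(-r) as n tends to infinity, in the sense of Poincare. *)
Definition asymptotic_expansion (u a : nat -> R) : Prop :=
  forall m : nat, (1 <= m)%nat ->
    exists C : R, eventually (fun n : nat =>
      Rabs (u n - sum_f_R0 (fun r => a r / INR n ^ r) (m - 1))
      <= C / INR n ^ m).

(* Main.v *)
(* Integrating [e^(-x) x^n] and [e^x x^(-n-1)] over [n, n+1] gives, with
   E(z) = e^(-1) (1+z)^(1/z) and I(z) = int_0^1 e^(-s) (1+sz)^(1/z) ds, the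
   recurrences
     theta_(n+1) E(z) = theta_n - 1 + I(z)    at z = 1/n,
     Psi_n E(z) = Psi_(n+1) + 1 - I(z)        at z = -1/(n+1).
   So the formal series sum_r rho_r z^r and -sum_r psi_r (-z)^r both satisfy
   T(z/(1+z)) E(z) = T(z) - 1 + I(z), as E and I are analytic at 0.  This equation
   has at most one formal solution: the difference Q of two of them satisfies
   Q(z/(1+z)) E(z) = Q(z), and as E(z) = 1 - z/2 + O(z^2), a leading term q z^j
   would give (j + 1/2) q = 0.  Of Ei, only Ei(n+1) - Ei(n) is used. *)
Require Import Defs.
From Stdlib Require Import Reals Lra Lia Arith Factorial.
From Coquelicot Require Import Coquelicot.
Open Scope R_scope.

(** * Two-sided expansions at 0 *)

(** What is known of theta lives at the points 1/n > 0, what is known of Psi at points -1/n < 0, so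
    the two expansions cannot be compared directly. The bridge is that the defect of a truncated
    series in the functional equation is built from a polynomial, z/(1+z), E and I only, all of them
    smooth across 0. If it is O(z^m) along one sequence tending to 0, its Taylor coefficients below
    m vanish, and it is O(z^m) on both sides of 0.

    Only finite-order expansions with bounded remainder replace analyticity. They carry a parameter
    s because I integrates a kernel over s, and because exp and the logarithm are themselves
    expanded through integral remainders.

    The leading-coefficient argument becomes an estimate for small z < 0, where E(z) >= 1 + |z|/2
    already supplies the nonzero first-order term. *)

Lemma Rmin_gt (x a b : R) : x < Rmin a b -> x < a /\ x < b.
Proof. apply Rmin_Rgt_l. Qed.

(* [f s z] has an expansion in powers of [z] up to [O(z^m)], two-sided in [z] and
   uniform in the parameter [0 <= s <= 1], with coefficients continuous in [s].
   The value at [z = 0] is constrained too, which makes [expandable_comp]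
   true without excluding zeros of the inner function. *)
Fixpoint expandable (m : nat) (f : R -> R -> R) : Prop :=
  match m with
  | O => exists C d, 0 < d /\
      forall s z, 0 <= s <= 1 -> Rabs z < d -> Rabs (f s z) <= C
  | S m' => exists a g, (forall s, 0 <= s <= 1 -> continuous a s) /\
      expandable m' g /\
      exists d, 0 < d /\
        forall s z, 0 <= s <= 1 -> Rabs z < d -> f s z = a s + z * g s z
  end.

Lemma continuous_unit_bounded (a : R -> R) :
  (forall s, 0 <= s <= 1 -> continuous a s) ->
  exists C, 0 <= C /\ forall s, 0 <= s <= 1 -> Rabs (a s) <= C.
Proof.
  intros Ha.
  destruct (continuity_ab_maj (fun s => Rabs (a s)) 0 1) as [x [Hx _]].
  - lra.
  - intros c Hc. apply continuity_pt_filterlim.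
    apply (continuous_comp a Rabs); [now apply Ha|apply continuous_Rabs].
  - exists (Rabs (a x)). split; [apply Rabs_pos|exact Hx].
Qed.

Lemma expandable_bounded (m : nat) (f : R -> R -> R) :
  expandable m f ->
  exists C d, 0 <= C /\ 0 < d /\
    forall s z, 0 <= s <= 1 -> Rabs z < d -> Rabs (f s z) <= C.
Proof.
  revert f; induction m as [|m IH]; intros f.
  - intros [C [d [Hd H]]]. exists C, d. split; [|now split].
    apply Rle_trans with (2 := H 0 0 ltac:(lra) ltac:(rewrite Rabs_R0; lra)).
    apply Rabs_pos.
  - intros [a [g [Ha [Hg [d [Hd H]]]]]].
    destruct (continuous_unit_bounded a Ha) as [A [HA HaA]].
    destruct (IH g Hg) as [C [e [HC [He HgC]]]].
    exists (A + d * C), (Rmin d e).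
    split; [assert (0 <= d * C) by (apply Rmult_le_pos; lra); lra|].
    split; [now apply Rmin_pos|].
    intros s z Hs Hz.
    apply Rmin_gt in Hz as [Hzd Hze].
    rewrite (H s z Hs Hzd).
    eapply Rle_trans; [apply Rabs_triang|].
    apply Rplus_le_compat; [now apply HaA|].
    rewrite Rabs_mult.
    apply Rmult_le_compat; try apply Rabs_pos; [lra|now apply HgC].
Qed.

Lemma expandable_pred (m : nat) (f : R -> R -> R) :
  expandable (S m) f -> expandable m f.
Proof.
  revert f; induction m as [|m IH]; intros f Hf.
  - destruct (expandable_bounded 1 f Hf) as [C [d [_ [Hd H]]]].
    now exists C, d.
  - destruct Hf as [a [g [Ha [Hg H]]]].
    exists a, g. split; [exact Ha|split; [now apply IH|exact H]].
Qed.

Lemma expandable_ext (m : nat) (f g : R -> R -> R) (d : R) :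
  0 < d ->
  (forall s z, 0 <= s <= 1 -> Rabs z < d -> f s z = g s z) ->
  expandable m f -> expandable m g.
Proof.
  intros Hd E. destruct m as [|m]; simpl.
  - intros [C [e [He H]]]. exists C, (Rmin d e).
    split; [now apply Rmin_pos|].
    intros s z Hs Hz. apply Rmin_gt in Hz as [Hzd Hze].
    rewrite <- E by assumption. now apply H.
  - intros [a [k [Ha [Hk [e [He H]]]]]]. exists a, k.
    split; [exact Ha|split; [exact Hk|]].
    exists (Rmin d e). split; [now apply Rmin_pos|].
    intros s z Hs Hz. apply Rmin_gt in Hz as [Hzd Hze].
    rewrite <- E by assumption. now apply H.
Qed.

Lemma expandable_coef (m : nat) (a : R -> R) :
  (forall s, 0 <= s <= 1 -> continuous a s) -> expandable m (fun s _ => a s).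
Proof.
  revert a; induction m as [|m IH]; intros a Ha.
  - destruct (continuous_unit_bounded a Ha) as [C [_ HC]].
    exists C, 1. split; [lra|]. intros s z Hs _. now apply HC.
  - exists a, (fun _ _ => 0). split; [exact Ha|split].
    + apply (IH (fun _ => 0)). intros s _. apply continuous_const.
    + exists 1. split; [lra|]. intros; ring.
Qed.

Lemma expandable_const (m : nat) (c : R) : expandable m (fun _ _ => c).
Proof.
  apply (expandable_coef m (fun _ => c)). intros s _. apply continuous_const.
Qed.

Lemma expandable_var (m : nat) : expandable m (fun _ z => z).
Proof.
  destruct m as [|m].
  - exists 1, 1. split; [lra|]. intros; lra.
  - exists (fun _ => 0), (fun _ _ => 1). split; [|split].
    + intros s _. apply continuous_const.
    + apply expandable_const.
    + exists 1. split; [lra|]. intros; ring.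
Qed.

Lemma expandable_plus (m : nat) (f g : R -> R -> R) :
  expandable m f -> expandable m g -> expandable m (fun s z => f s z + g s z).
Proof.
  revert f g; induction m as [|m IH]; intros f g.
  - intros [C [d [Hd Hf]]] [D [e [He Hg]]].
    exists (C + D), (Rmin d e). split; [now apply Rmin_pos|].
    intros s z Hs Hz. apply Rmin_gt in Hz as [Hzd Hze].
    eapply Rle_trans; [apply Rabs_triang|].
    now apply Rplus_le_compat; [apply Hf|apply Hg].
  - intros [a [f' [Ha [Hf' [d [Hd Hf]]]]]] [b [g' [Hb [Hg' [e [He Hg]]]]]].
    exists (fun s => a s + b s), (fun s z => f' s z + g' s z).
    split; [|split; [now apply IH|]].
    + intros s Hs. apply (continuous_plus a b); [now apply Ha|now apply Hb].
    + exists (Rmin d e). split; [now apply Rmin_pos|].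
      intros s z Hs Hz.
      apply Rmin_gt in Hz as [Hzd Hze].
      rewrite Hf, Hg by assumption.
      ring.
Qed.

Lemma expandable_mult (m : nat) (f g : R -> R -> R) :
  expandable m f -> expandable m g -> expandable m (fun s z => f s z * g s z).
Proof.
  revert f g; induction m as [|m IH]; intros f g.
  - intros [C [d [Hd Hf]]] [D [e [He Hg]]].
    exists (C * D), (Rmin d e). split; [now apply Rmin_pos|].
    intros s z Hs Hz. apply Rmin_gt in Hz as [Hzd Hze]. rewrite Rabs_mult.
    apply Rmult_le_compat; try apply Rabs_pos; [now apply Hf|now apply Hg].
  - intros [a [f' [Ha [Hf' [d [Hd Hf]]]]]] Hg0.
    assert (Hgm := expandable_pred _ _ Hg0).
    destruct Hg0 as [b [g' [Hb [Hg' [e [He Hg]]]]]].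
    exists (fun s => a s * b s), (fun s z => a s * g' s z + f' s z * g s z).
    split; [|split].
    + intros s Hs. apply (continuous_mult a b); [now apply Ha|now apply Hb].
    + apply expandable_plus; apply IH; try assumption.
      now apply expandable_coef.
    + exists (Rmin d e). split; [now apply Rmin_pos|].
      intros s z Hs Hz.
      apply Rmin_gt in Hz as [Hzd Hze].
      rewrite Hf, Hg by assumption.
      ring.
Qed.

Lemma expandable_opp (m : nat) (f : R -> R -> R) :
  expandable m f -> expandable m (fun s z => - f s z).
Proof.
  intros Hf.
  apply (expandable_ext m (fun s z => (-1) * f s z) _ 1); [lra|intros; ring|].
  apply (expandable_mult m (fun _ _ => -1) f); [apply expandable_const|exact Hf].
Qed.

Lemma expandable_minus (m : nat) (f g : R -> R -> R) :
  expandable m f -> expandable m g -> expandable m (fun s z => f s z - g s z).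
Proof.
  intros Hf Hg. apply (expandable_plus m f (fun s z => - g s z) Hf).
  now apply expandable_opp.
Qed.

Lemma expandable_pow (m j : nat) (f : R -> R -> R) :
  expandable m f -> expandable m (fun s z => f s z ^ j).
Proof.
  intros Hf. induction j as [|j IH]; simpl.
  - apply expandable_const.
  - now apply expandable_mult.
Qed.

(** The explicit factor [z] makes the inner function small near 0, uniformly in [s], and each order
    split off [f] yields a full factor [z]: at [w = z * k s z], [a s + w * g s w] is
    [a s + z * (k s z * g s w)]. *)
Lemma expandable_comp (m : nat) (f k : R -> R -> R) :
  expandable m f -> expandable m k ->
  expandable m (fun s z => f s (z * k s z)).
Proof.
  intros Hf Hk.
  destruct (expandable_bounded m k Hk) as [K [e [HK [He HkK]]]].
  assert (Hsmall : forall d, 0 < d -> exists e', 0 < e' /\ forall s z,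
    0 <= s <= 1 -> Rabs z < e' -> Rabs (z * k s z) < d).
  { intros d Hd. exists (Rmin e (d / (K + 1))).
    split; [apply Rmin_pos; [exact He|apply Rdiv_lt_0_compat; lra]|].
    intros s z Hs Hz.
    apply Rmin_gt in Hz as [Hze Hzd].
    rewrite Rabs_mult.
    apply Rle_lt_trans with (Rabs z * (K + 1)).
    - apply Rmult_le_compat_l; [apply Rabs_pos|].
      apply Rle_trans with K; [now apply HkK|lra].
    - apply Rlt_le_trans with (d / (K + 1) * (K + 1)).
      + apply Rmult_lt_compat_r; lra.
      + right; field; lra. }
  clear HkK He e HK K.
  revert f k Hf Hk Hsmall; induction m as [|m IH]; intros f k Hf Hk Hsmall.
  - destruct Hf as [C [d [Hd Hf]]].
    destruct (Hsmall d Hd) as [e [He H]].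
    exists C, e. split; [exact He|]. intros s z Hs Hz.
    apply Hf; [exact Hs|now apply H].
  - destruct Hf as [a [g [Ha [Hg [d [Hd Hf]]]]]].
    destruct (Hsmall d Hd) as [e [He H]].
    exists a, (fun s z => k s z * g s (z * k s z)).
    apply expandable_pred in Hk.
    split; [exact Ha|split].
    + apply expandable_mult; [exact Hk|now apply IH].
    + exists e. split; [exact He|]. intros s z Hs Hz.
      rewrite Hf by (try assumption; now apply H). ring.
Qed.

(** Integrate [a s + z * g s z] term by term. Continuity in [s] is asked only for [z <> 0], so that
    it passes to the remainder: there [g] is the quotient [(f s z - a s) / z], while at [z = 0]
    nothing is known of its regularity. *)
Lemma expandable_RInt (m : nat) (f : R -> R -> R) (d : R) :
  0 < d ->
  (forall s z, 0 <= s <= 1 -> Rabs z < d -> z <> 0 ->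
     continuous (fun s => f s z) s) ->
  expandable m f ->
  expandable m (fun _ z => RInt (fun s => f s z) 0 1).
Proof.
  revert f d; induction m as [|m IH]; intros f d Hd Hc.
  - intros [C [e [He H]]].
    exists (Rmax C (Rabs (RInt (fun s => f s 0) 0 1))), (Rmin d e).
    split; [now apply Rmin_pos|]. intros _ z _ Hz.
    apply Rmin_gt in Hz as [Hzd Hze].
    destruct (Req_dec z 0) as [->|Hz0]; [apply Rmax_r|].
    eapply Rle_trans; [|apply Rmax_l].
    replace C with ((1 - 0) * C) by ring.
    apply abs_RInt_le_const; [lra|..].
    + apply (ex_RInt_continuous (V := R_CompleteNormedModule)).
      intros s. rewrite Rmin_left, Rmax_right by lra. intros Hs.
      now apply Hc.
    + intros s Hs. now apply H.
  - intros [a [g [Ha [Hg [e [He H]]]]]].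
    assert (Hgc : forall s z, 0 <= s <= 1 -> Rabs z < Rmin d e -> z <> 0 ->
      continuous (fun s => (f s z - a s) / z) s).
    { intros s z Hs Hz Hz0. apply Rmin_gt in Hz as [Hzd Hze].
      apply (continuous_mult (fun s => f s z - a s) (fun _ => / z));
        [|apply continuous_const].
      apply (continuous_minus (V := R_NormedModule) (fun s => f s z) a).
      - now apply Hc.
      - now apply Ha. }
    (* [g] is the quotient only for [0 <= s <= 1], while continuity at the endpoints looks beyond
       them. For [z <> 0], [g'] is the quotient for every [s]; at [z = 0] it keeps the value of
       [g]. *)
    set (g' := fun s z => if Req_EM_T z 0 then g s z else (f s z - a s) / z).
    assert (Hg' : expandable m g').
    { apply (expandable_ext m g g' (Rmin d e)); [now apply Rmin_pos| |exact Hg].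
      intros s z Hs Hz. apply Rmin_gt in Hz as [Hzd Hze].
      unfold g'. destruct (Req_EM_T z 0) as [|Hz0]; [easy|].
      rewrite H by assumption. field. exact Hz0. }
    exists (fun _ => RInt a 0 1), (fun _ z => RInt (fun s => g' s z) 0 1).
    split; [intros; apply continuous_const|split].
    + apply (IH g' (Rmin d e)); [now apply Rmin_pos| |exact Hg'].
      intros s z Hs Hz Hz0.
      eapply continuous_ext; [|apply (Hgc s z Hs Hz Hz0)].
      intros t. unfold g'. now destruct (Req_EM_T z 0).
    + exists (Rmin d e). split; [now apply Rmin_pos|]. intros _ z _ Hz.
      destruct (Req_EM_T z 0) as [->|Hz0].
      * rewrite Rmult_0_l, Rplus_0_r. apply RInt_ext.
        intros s. rewrite Rmin_left, Rmax_right by lra. intros Hs.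
        rewrite (H s 0) by (rewrite ?Rabs_R0; lra). rewrite Rmult_0_l. apply Rplus_0_r.
      * assert (ex_RInt a 0 1).
        { apply (ex_RInt_continuous (V := R_CompleteNormedModule)).
          intros s. rewrite Rmin_left, Rmax_right by lra. apply Ha. }
        assert (ex_RInt (fun s => g' s z) 0 1).
        { apply (ex_RInt_continuous (V := R_CompleteNormedModule)).
          intros s. rewrite Rmin_left, Rmax_right by lra. intros Hs.
          eapply continuous_ext; [|apply (Hgc s z Hs Hz Hz0)].
          intros t. unfold g'. now destruct (Req_EM_T z 0). }
        rewrite <- (RInt_scal (V := R_CompleteNormedModule)) by assumption.
        rewrite <- (RInt_plus (V := R_CompleteNormedModule));
          [|assumption|apply (ex_RInt_scal (V := R_NormedModule)); assumption].
        apply RInt_ext. intros s _.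
        unfold g', plus, scal; simpl; unfold mult; simpl.
        destruct (Req_EM_T z 0); [easy|field; exact Hz0].
Qed.

(** * Expansions of the kernel and of its integral *)

Lemma expandable_inv (m : nat) : expandable m (fun _ z => / (1 + z)).
Proof.
  induction m as [|m IH].
  - exists 2, (/ 2). split; [lra|]. intros _ z _ Hz.
    apply Rabs_def2 in Hz.
    rewrite Rabs_pos_eq by (left; apply Rinv_0_lt_compat; lra).
    rewrite <- (Rinv_inv 2). apply Rinv_le_contravar; lra.
  - exists (fun _ => 1), (fun _ z => - / (1 + z)).
    split; [intros; apply continuous_const|split].
    + now apply (expandable_opp m (fun _ z => / (1 + z))).
    + exists 1. split; [lra|]. intros _ z _ Hz. apply Rabs_def2 in Hz.
      field. lra.
Qed.

Lemma exp_eq_RInt (x : R) : exp x = 1 + x * RInt (fun t => exp (x * t)) 0 1.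
Proof.
  destruct (Req_dec x 0) as [->|Hx]; [rewrite exp_0; ring|].
  replace (RInt (fun t => exp (x * t)) 0 1)
    with (exp (x * 1) / x - exp (x * 0) / x).
  - rewrite Rmult_0_r, exp_0, Rmult_1_r. field. exact Hx.
  - symmetry. apply is_RInt_unique.
    apply (is_RInt_derive (V := R_CompleteNormedModule)
             (fun t => exp (x * t) / x) (fun t => exp (x * t))).
    + intros t _. auto_derive; [easy|]. field. exact Hx.
    + intros t _. apply (ex_derive_continuous (V := R_NormedModule)).
      now auto_derive.
Qed.

(** The remainder of order one is an average over [t] of [exp (z * t)], that is, of [exp] composed
    with a multiple of [z]; so [exp] reproduces itself one order lower, with [t] as the
    parameter. *)
Lemma expandable_exp (m : nat) : expandable m (fun _ z => exp z).
Proof.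
  induction m as [|m IH].
  - exists (exp 1), 1. split; [lra|]. intros _ z _ Hz. apply Rabs_def2 in Hz.
    rewrite Rabs_pos_eq by (left; apply exp_pos).
    left. apply exp_increasing. lra.
  - exists (fun _ => 1), (fun _ z => RInt (fun t => exp (z * t)) 0 1).
    split; [intros; apply continuous_const|split].
    + apply (expandable_RInt m (fun s z => exp (z * s)) 1); [lra|..].
      * intros s z _ _ _. apply (ex_derive_continuous (V := R_NormedModule)).
        now auto_derive.
      * apply (expandable_comp m (fun _ x => exp x) (fun s _ => s)); [exact IH|].
        apply (expandable_coef m (fun s => s)). intros; apply continuous_id.
    + exists 1. split; [lra|]. intros _ z _ _. apply exp_eq_RInt.
Qed.

(* [(x - ln (1 + x)) / x ^ 2], extended analytically to [x = 0]. *)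
Definition lam (x : R) : R := RInt (fun t => t / (1 + x * t)) 0 1.

Lemma one_plus_mult_pos (x t : R) : -1 < x -> 0 <= t <= 1 -> 0 < 1 + x * t.
Proof.
  intros Hx [[Ht|<-] Ht1]; [nra|lra].
Qed.

Lemma lam_continuous_integrand (x t : R) :
  -1 < x -> 0 <= t <= 1 -> continuous (fun t => t / (1 + x * t)) t.
Proof.
  intros Hx Ht. apply (ex_derive_continuous (V := R_NormedModule)).
  auto_derive. assert (Hp := one_plus_mult_pos x t Hx Ht). intros E.
  rewrite E in Hp. exact (Rlt_irrefl _ Hp).
Qed.

(** The function [x * t - ln (1 + x * t)] of [t] vanishes at 0 and has derivative
    [x ^ 2 * t / (1 + x * t)]. *)
Lemma ln_eq_lam (x : R) : -1 < x -> ln (1 + x) = x - x ^ 2 * lam x.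
Proof.
  intros Hx.
  enough (x - ln (1 + x) = x ^ 2 * lam x) by lra.
  unfold lam. rewrite <- (RInt_scal (V := R_CompleteNormedModule)).
  2:{ apply (ex_RInt_continuous (V := R_CompleteNormedModule)).
      intros t. rewrite Rmin_left, Rmax_right by lra.
      now apply lam_continuous_integrand. }
  replace (x - ln (1 + x))
    with ((x * 1 - ln (1 + x * 1)) - (x * 0 - ln (1 + x * 0)))
    by (rewrite Rmult_0_r, Rmult_1_r, Rplus_0_r, ln_1; ring).
  symmetry. apply is_RInt_unique.
  apply (is_RInt_derive (V := R_CompleteNormedModule)
           (fun t => x * t - ln (1 + x * t))
           (fun t => scal (x ^ 2) (t / (1 + x * t)))).
  - intros t. rewrite Rmin_left, Rmax_right by lra. intros Ht.
    assert (Hp := one_plus_mult_pos x t Hx Ht).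
    auto_derive; [easy|]. unfold scal; simpl; unfold mult; simpl. field. lra.
  - intros t. rewrite Rmin_left, Rmax_right by lra. intros Ht.
    apply (continuous_scal_r (V := R_NormedModule)).
    now apply lam_continuous_integrand.
Qed.

Lemma expandable_lam (m : nat) : expandable m (fun _ x => lam x).
Proof.
  apply (expandable_RInt m (fun t x => t / (1 + x * t)) 1); [lra|..].
  - intros t x Ht Hx _. apply Rabs_def2 in Hx.
    now apply lam_continuous_integrand.
  - assert (Hid : expandable m (fun s _ => s))
      by (apply (expandable_coef m (fun s => s)); intros; apply continuous_id).
    apply (expandable_mult m (fun s _ => s) (fun s x => / (1 + x * s)));
      [exact Hid|].
    exact (expandable_comp m (fun _ z => / (1 + z)) _ (expandable_inv m) Hid).
Qed.

Lemma lam_lower_bound (x : R) : -1 < x <= 0 -> / 2 <= lam x.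
Proof.
  intros Hx.
  replace (/ 2) with (RInt (fun t => t) 0 1).
  - apply RInt_le; [lra|..].
    + apply (ex_RInt_continuous (V := R_CompleteNormedModule)).
      intros; apply continuous_id.
    + apply (ex_RInt_continuous (V := R_CompleteNormedModule)).
      intros t. rewrite Rmin_left, Rmax_right by lra.
      apply lam_continuous_integrand. lra.
    + intros t Ht. assert (Hp := one_plus_mult_pos x t (proj1 Hx) ltac:(lra)).
      assert (1 + x * t <= 1) by nra.
      rewrite <- (Rdiv_1_r t) at 1. unfold Rdiv.
      apply Rmult_le_compat_l; [lra|]. apply Rinv_le_contravar; lra.
  - apply is_RInt_unique.
    replace (/ 2) with (1 ^ 2 / 2 - 0 ^ 2 / 2) by field.
    apply (is_RInt_derive (V := R_CompleteNormedModule)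
             (fun t => t ^ 2 / 2) (fun t => t)).
    + intros t _. auto_derive; [easy|field].
    + intros; apply continuous_id.
Qed.

(* [exp (- s) * (1 + s * z) ^ (1 / z)], extended analytically to [z = 0]. *)
Definition gker (s z : R) : R := exp (z * - (s ^ 2 * lam (z * s))).

Lemma gker_eq (s z : R) :
  z <> 0 -> -1 < z * s -> gker s z = exp (ln (1 + z * s) / z - s).
Proof.
  intros Hz Hzs. unfold gker. f_equal. rewrite ln_eq_lam by exact Hzs.
  field. exact Hz.
Qed.

Lemma expandable_gker (m : nat) : expandable m gker.
Proof.
  assert (Hid : expandable m (fun s _ => s))
    by (apply (expandable_coef m (fun s => s)); intros; apply continuous_id).
  apply (expandable_comp m (fun _ z => exp z)
           (fun s z => - (s ^ 2 * lam (z * s)))); [apply expandable_exp|].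
  apply (expandable_opp m (fun s z => s ^ 2 * lam (z * s))).
  apply (expandable_mult m (fun s _ => s ^ 2) (fun s z => lam (z * s))).
  - now apply (expandable_pow m 2 (fun s _ => s)).
  - exact (expandable_comp m (fun _ x => lam x) _ (expandable_lam m) Hid).
Qed.

(** For [z <> 0] the closed form is valid wherever [1 + z * t > 0], an open set that contains a
    neighbourhood of [s] even when [s] is an endpoint. *)
Lemma continuous_gker (s z : R) :
  0 <= s <= 1 -> -1 < z -> z <> 0 -> continuous (fun s => gker s z) s.
Proof.
  intros Hs Hz Hz0.
  assert (Hp := one_plus_mult_pos z s Hz Hs).
  apply continuous_ext_loc with (fun s => exp (ln (1 + z * s) / z - s)).
  - assert (Hcont : continuous (fun t => 1 + z * t) s).
    { apply (ex_derive_continuous (V := R_NormedModule)). now auto_derive. }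
    generalize (Hcont (fun y => 0 < y) (open_gt 0 _ Hp)).
    unfold filtermap. apply filter_imp. intros t Ht.
    symmetry. apply gker_eq; [exact Hz0|lra].
  - apply (ex_derive_continuous (V := R_NormedModule)).
    auto_derive. lra.
Qed.

(** This is I of the overview, and [gker 1] is E, both with a value at [z = 0]. *)
Definition gint (z : R) : R := RInt (fun s => gker s z) 0 1.

Lemma expandable_gint (m : nat) : expandable m (fun _ z => gint z).
Proof.
  apply (expandable_RInt m gker 1); [lra| |apply expandable_gker].
  intros s z Hs Hz Hz0. apply Rabs_def2 in Hz. now apply continuous_gker.
Qed.

Lemma expandable_gker_1 (m : nat) : expandable m (fun _ z => gker 1 z).
Proof.
  apply (expandable_ext m (fun _ z => exp (z * - lam z)) _ 1); [lra|..].
  - intros _ z _ _. unfold gker. f_equal. rewrite Rmult_1_r. ring.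
  - apply (expandable_comp m (fun _ z => exp z) (fun _ z => - lam z));
      [apply expandable_exp|].
    apply (expandable_opp m (fun _ z => lam z)), expandable_lam.
Qed.

(* This is what allows a passage from positive to negative [z]: a bound along one
   null sequence forces the coefficients below [m] to vanish. *)
Lemma expandable_bigO_of_seq (m : nat) (f : R -> R -> R) (u : nat -> R)
  (C : R) :
  expandable m f -> is_lim_seq u 0 -> (forall n, u n <> 0) ->
  eventually (fun n => Rabs (f 0 (u n)) <= C * Rabs (u n) ^ m) ->
  exists K d, 0 < d /\ forall z, Rabs z < d -> Rabs (f 0 z) <= K * Rabs z ^ m.
Proof.
  intros Hf Hu Hu0. revert f Hf; induction m as [|m IH]; intros f Hf HC.
  - destruct Hf as [K [d [Hd HK]]]. exists K, d. split; [exact Hd|].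
    intros z Hz. rewrite Rmult_1_r. apply HK; [lra|exact Hz].
  - destruct Hf as [a [g [Ha [Hg [d [Hd Hf]]]]]].
    assert (Hud : forall e, 0 < e -> eventually (fun n => Rabs (u n) < e)).
    { intros e He. apply is_lim_seq_spec in Hu.
      destruct (Hu (mkposreal e He)) as [N HN]. exists N. intros n Hn.
      rewrite <- (Rminus_0_r (u n)). now apply HN. }
    destruct (expandable_bounded m g Hg) as [M [e [HM [He HgM]]]].
    (* At [z = u n], [a 0] is [f - z * g]; the first term is bounded by hypothesis, the second by
       [M * Rabs (u n)], and both bounds tend to 0. *)
    assert (Ha0 : a 0 = 0).
    { assert (Hlim : is_lim_seq (fun n => Rabs (u n) * (C * Rabs (u n) ^ m + M))
                       0).
      { assert (Hul : is_lim_seq (fun n => Rabs (u n)) 0)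
          by (apply -> is_lim_seq_abs_0; exact Hu).
        replace (Finite 0) with (Finite (0 * (C * 0 ^ m + M)))
          by (f_equal; ring).
        apply is_lim_seq_mult'; [exact Hul|].
        apply is_lim_seq_plus'; [|apply is_lim_seq_const].
        apply is_lim_seq_mult'; [apply is_lim_seq_const|].
        clear -Hul. induction m as [|m IH]; simpl;
          [apply is_lim_seq_const|now apply is_lim_seq_mult']. }
      assert (Hle : Rbar_le (Rabs (a 0)) 0).
      { eapply (is_lim_seq_le_loc (fun _ => Rabs (a 0)));
          [|apply is_lim_seq_const|exact Hlim].
        generalize (filter_and _ _ HC (filter_and _ _ (Hud d Hd) (Hud e He))).
        apply filter_imp. intros n [H1 [H2 H3]].
        rewrite Hf in H1 by (try lra; exact H2).
        replace (a 0) with ((a 0 + u n * g 0 (u n)) + - (u n * g 0 (u n)))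
          by ring.
        eapply Rle_trans; [apply Rabs_triang|].
        rewrite Rabs_Ropp, Rabs_mult, Rmult_plus_distr_l.
        apply Rplus_le_compat; [simpl in H1; lra|].
        apply Rmult_le_compat_l; [apply Rabs_pos|].
        apply HgM; [lra|exact H3]. }
      simpl in Hle. generalize (Rabs_pos (a 0)). intros H0.
      destruct (Req_dec (a 0) 0) as [|Hn]; [easy|].
      generalize (Rabs_pos_lt _ Hn). lra. }
    destruct (IH g Hg) as [K [e' [He' HK]]].
    { generalize (filter_and _ _ HC (Hud d Hd)). apply filter_imp.
      intros n [H1 H2]. rewrite Hf, Ha0, Rplus_0_l, Rabs_mult in H1
        by (try lra; exact H2).
      (* Dividing by [Rabs (u n)], which is nonzero, turns the bound of order [m + 1] on [f] into
         one of order [m] on [g]. *)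
      apply Rmult_le_reg_l with (Rabs (u n)); [now apply Rabs_pos_lt|].
      simpl in H1. lra. }
    exists K, (Rmin d e'). split; [now apply Rmin_pos|]. intros z Hz.
    apply Rmin_gt in Hz as [Hzd Hze].
    rewrite Hf, Ha0, Rplus_0_l, Rabs_mult by (try lra; assumption).
    simpl. replace (K * (Rabs z * Rabs z ^ m))
      with (Rabs z * (K * Rabs z ^ m)) by ring.
    apply Rmult_le_compat_l; [apply Rabs_pos|]. now apply HK.
Qed.

(** * The formal functional equation *)

Definition partial (a : nat -> R) (m : nat) (z : R) : R :=
  sum_f_R0 (fun r => a r * z ^ r) (m - 1).

Lemma expandable_partial (k m : nat) (a : nat -> R) :
  expandable k (fun _ z => partial a m z).
Proof.
  unfold partial. generalize (m - 1)%nat as N.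
  assert (Hterm : forall r, expandable k (fun _ z => a r * z ^ r)).
  { intros r. apply (expandable_mult k (fun _ _ => a r) (fun _ z => z ^ r)).
    - apply expandable_const.
    - apply (expandable_pow k r (fun _ z => z)), expandable_var. }
  intros N; induction N as [|N IH]; simpl.
  - apply (Hterm 0%nat).
  - exact (expandable_plus k _ _ IH (Hterm (S N))).
Qed.

(* The recurrences of [theta] (at [z = 1/n]) and of [-Psi] (at [z = -1/(n+1)]) both
   say that this is small when [partial a m] approximates the sequence: the map
   [z |-> z / (1 + z)] sends [1/n] to [1/(n+1)] and [-1/(n+1)] to [-1/n]. *)
Definition residual (a : nat -> R) (m : nat) (z : R) : R :=
  partial a m (z * / (1 + z)) * gker 1 z - partial a m z + 1 - gint z.

Lemma expandable_residual (k m : nat) (a : nat -> R) :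
  expandable k (fun _ z => residual a m z).
Proof.
  unfold residual.
  apply (expandable_minus k (fun _ z => partial a m (z * / (1 + z)) * gker 1 z
                                     - partial a m z + 1) (fun _ z => gint z));
    [|apply expandable_gint].
  apply (expandable_plus k (fun _ z => partial a m (z * / (1 + z)) * gker 1 z
                                     - partial a m z) (fun _ _ => 1));
    [|apply expandable_const].
  apply (expandable_minus k (fun _ z => partial a m (z * / (1 + z)) * gker 1 z)
           (fun _ z => partial a m z)); [|apply expandable_partial].
  apply (expandable_mult k (fun _ z => partial a m (z * / (1 + z)))
           (fun _ z => gker 1 z)); [|apply expandable_gker_1].
  exact (expandable_comp k (fun _ z => partial a m z) _
           (expandable_partial k m a) (expandable_inv k)).
Qed.

(** Subtracting the exact relation between [x n] and [y n] from the residual at [u n] leaves only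
    the two approximation errors, one of them multiplied by the bounded factor [gker 1 (u n)]. This
    gives the bound along [u], which then extends to a neighbourhood of 0. *)
Lemma residual_bigO (a x y u : nat -> R) (m : nat) (C : R) :
  is_lim_seq u 0 -> (forall n, u n <> 0) ->
  (forall n, y n * gker 1 (u n) - x n + 1 - gint (u n) = 0) ->
  eventually (fun n => Rabs (x n - partial a m (u n)) <= C * Rabs (u n) ^ m) ->
  eventually (fun n => Rabs (y n - partial a m (u n * / (1 + u n)))
                         <= C * Rabs (u n) ^ m) ->
  exists K d, 0 < d /\
    forall z, Rabs z < d -> Rabs (residual a m z) <= K * Rabs z ^ m.
Proof.
  intros Hu Hu0 Hrec Hx Hy.
  destruct (expandable_bounded 0 _ (expandable_gker_1 0))
    as [M [e [HM [He HE]]]].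
  apply (expandable_bigO_of_seq m (fun _ z => residual a m z) u (C * M + C));
    [apply expandable_residual|exact Hu|exact Hu0|].
  assert (Hue : eventually (fun n => Rabs (u n) < e)).
  { apply is_lim_seq_spec in Hu.
    destruct (Hu (mkposreal e He)) as [N HN]. exists N. intros n Hn.
    rewrite <- (Rminus_0_r (u n)). now apply HN. }
  generalize (filter_and _ _ Hue (filter_and _ _ Hx Hy)).
  apply filter_imp. intros n [H1 [H2 H3]].
  replace (residual a m (u n))
    with (- (y n - partial a m (u n * / (1 + u n))) * gker 1 (u n)
          + (x n - partial a m (u n)))
    by (unfold residual; specialize (Hrec n); lra).
  eapply Rle_trans; [apply Rabs_triang|].
  rewrite Rmult_plus_distr_r. apply Rplus_le_compat; [|exact H2].
  rewrite Rabs_mult, Rabs_Ropp.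
  replace (C * M * Rabs (u n) ^ m) with (C * Rabs (u n) ^ m * M) by ring.
  apply Rmult_le_compat; try apply Rabs_pos; [exact H3|].
  apply (HE 0); [lra|exact H1].
Qed.

Lemma partial_minus_leading (a b : nat -> R) (j : nat) (z : R) :
  (forall i, (i < j)%nat -> a i = b i) ->
  partial a (S (S j)) z - partial b (S (S j)) z
  = z ^ j * ((a j - b j) + (a (S j) - b (S j)) * z).
Proof.
  intros H. unfold partial.
  replace (S (S j) - 1)%nat with (S j) by lia.
  assert (Hj : sum_f_R0 (fun r => a r * z ^ r) j
             - sum_f_R0 (fun r => b r * z ^ r) j = (a j - b j) * z ^ j).
  { destruct j as [|j]; simpl; [ring|].
    rewrite (sum_eq (fun r => a r * z ^ r) (fun r => b r * z ^ r) j); [ring|].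
    intros i Hi. rewrite H by lia. reflexivity. }
  simpl. simpl in Hj. lra.
Qed.

Lemma pow_ge_1 (v : R) (j : nat) : 1 <= v -> 1 <= v ^ j.
Proof. intros H. rewrite <- (pow1 j). apply pow_incr. lra. Qed.

(** The exponent is [Rabs z * lam z] with [lam z >= 1/2], and [exp y >= 1 + y]. On this side of 0,
    [/ (1 + z)] is at least 1 as well, so its powers can only help. *)
Lemma gker_1_lower (z : R) : -1 < z <= 0 -> 1 + Rabs z / 2 <= gker 1 z.
Proof.
  intros Hz. unfold gker. rewrite Rabs_left1, Rmult_1_r by lra.
  assert (Hl := lam_lower_bound z Hz).
  eapply Rle_trans; [|apply exp_ineq1_le]. nra.
Qed.

(* If [D] is the first nonzero difference [a j - b j], the two residuals differ by
   [D * z ^ j * (gker 1 z / (1 + z) ^ j - 1)] to leading order, and for [z < 0] the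
   last factor is at least [|z| / 2]. *)
Lemma residual_unique (a b : nat -> R) :
  (forall m, (1 <= m)%nat -> exists K d, 0 < d /\
    forall z, Rabs z < d -> Rabs (residual a m z) <= K * Rabs z ^ m) ->
  (forall m, (1 <= m)%nat -> exists K d, 0 < d /\
    forall z, Rabs z < d -> Rabs (residual b m z) <= K * Rabs z ^ m) ->
  forall r, a r = b r.
Proof.
  intros Ha Hb r. induction r as [j IH] using (well_founded_induction Nat.lt_wf_0).
  (* Order [j + 2] is required: the factor of [D] vanishes to first order at 0, so [D] shows up only
     at order [j + 1]. The next difference [D1] comes with [z ^ (j + 1)] and a factor that is O(z)
     by [HV], so it does not disturb that order. *)
  destruct (Ha (S (S j)) ltac:(lia)) as [K [d [Hd HK]]].
  destruct (Hb (S (S j)) ltac:(lia)) as [L [e [He HL]]].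
  assert (HV : exists M h, 0 <= M /\ 0 < h /\ forall z, Rabs z < h ->
    Rabs ((/ (1 + z)) ^ S j * gker 1 z - 1) <= M * Rabs z).
  { assert (Hexp : expandable 1 (fun _ z => (/ (1 + z)) ^ S j * gker 1 z)).
    { apply (expandable_mult 1 (fun _ z => (/ (1 + z)) ^ S j)
               (fun _ z => gker 1 z)); [|apply expandable_gker_1].
      apply (expandable_pow 1 (S j) (fun _ z => / (1 + z))), expandable_inv. }
    destruct Hexp as [c [g [_ [Hg [h [Hh H]]]]]].
    destruct (expandable_bounded 0 g Hg) as [M [h' [HM [Hh' HgM]]]].
    exists M, (Rmin h h'). split; [exact HM|].
    split; [now apply Rmin_pos|]. intros z Hz.
    apply Rmin_gt in Hz as [Hz Hz'].
    assert (Hc : c 0 = 1).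
    { generalize (H 0 0 ltac:(lra) ltac:(rewrite Rabs_R0; exact Hh)).
      unfold gker. rewrite Rplus_0_r, Rinv_1, pow1, !Rmult_0_l, exp_0. lra. }
    rewrite (H 0) by (try lra; exact Hz). rewrite Hc.
    replace (1 + z * g 0 z - 1) with (g 0 z * z) by ring.
    rewrite Rabs_mult. apply Rmult_le_compat_r; [apply Rabs_pos|].
    apply HgM; [lra|exact Hz']. }
  destruct HV as [M [h [HM [Hh HV]]]].
  set (D := a j - b j). set (D1 := a (S j) - b (S j)).
  set (B := Rabs (K + L) + Rabs D1 * M).
  assert (HB : 0 <= B).
  { apply Rplus_le_le_0_compat; [apply Rabs_pos|].
    apply Rmult_le_pos; [apply Rabs_pos|exact HM]. }
  assert (Hmain : forall z, -1 < z < 0 -> Rabs z < d -> Rabs z < e ->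
    Rabs z < h -> Rabs D <= 2 * B * Rabs z).
  { intros z Hz1 Hzd Hze Hzh.
    specialize (HK z Hzd). specialize (HL z Hze). specialize (HV z Hzh).
    assert (Hz0 : 0 < Rabs z) by (apply Rabs_pos_lt; lra).
    set (v := / (1 + z)) in *. set (E := gker 1 z) in *.
    assert (Hdiff : Rabs (D * (v ^ j * E - 1) + D1 * z * (v ^ S j * E - 1))
                    <= (K + L) * (Rabs z * Rabs z)).
    { apply Rmult_le_reg_l with (Rabs (z ^ j));
        [apply Rabs_pos_lt, pow_nonzero; lra|].
      rewrite <- Rabs_mult.
      replace (z ^ j * (D * (v ^ j * E - 1) + D1 * z * (v ^ S j * E - 1)))
        with (residual a (S (S j)) z - residual b (S (S j)) z).
      - unfold Rminus at 1. eapply Rle_trans; [apply Rabs_triang|].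
        rewrite Rabs_Ropp, <- RPow_abs. simpl in HK, HL.
        eapply Rle_trans; [apply Rplus_le_compat; [exact HK|exact HL]|].
        right; ring.
      - unfold residual. fold v E.
        replace (partial a (S (S j)) (z * v) * E - partial a (S (S j)) z + 1
                 - gint z
                 - (partial b (S (S j)) (z * v) * E - partial b (S (S j)) z + 1
                    - gint z))
          with ((partial a (S (S j)) (z * v) - partial b (S (S j)) (z * v)) * E
                - (partial a (S (S j)) z - partial b (S (S j)) z)) by ring.
        rewrite !partial_minus_leading by exact IH.
        fold D D1. rewrite Rpow_mult_distr. simpl. ring. }
    assert (Hlow : Rabs z / 2 <= v ^ j * E - 1).
    { assert (H1 : 1 <= v ^ j).
      { apply pow_ge_1. unfold v. rewrite <- Rinv_1 at 1.
        apply Rinv_le_contravar; lra. }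
      assert (H2 := gker_1_lower z ltac:(lra)). fold E in H2. nra. }
    assert (HD : Rabs D * (v ^ j * E - 1) <= B * (Rabs z * Rabs z)).
    { rewrite <- (Rabs_pos_eq (v ^ j * E - 1)) by lra.
      rewrite <- Rabs_mult.
      replace (D * (v ^ j * E - 1))
        with (D * (v ^ j * E - 1) + D1 * z * (v ^ S j * E - 1)
              + - (D1 * z * (v ^ S j * E - 1))) by ring.
      eapply Rle_trans; [apply Rabs_triang|]. rewrite Rabs_Ropp.
      unfold B. rewrite Rmult_plus_distr_r. apply Rplus_le_compat.
      - eapply Rle_trans; [exact Hdiff|].
        apply Rmult_le_compat_r; [nra|apply Rle_abs].
      - rewrite !Rabs_mult.
        replace (Rabs D1 * M * (Rabs z * Rabs z))
          with (Rabs D1 * Rabs z * (M * Rabs z)) by ring.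
        apply Rmult_le_compat_l; [|exact HV].
        apply Rmult_le_pos; apply Rabs_pos. }
    assert (HD2 : Rabs D * (Rabs z / 2) <= Rabs D * (v ^ j * E - 1))
      by (apply Rmult_le_compat_l; [apply Rabs_pos|exact Hlow]).
    apply Rmult_le_reg_r with (Rabs z / 2); [lra|].
    lra. }
  destruct (Req_dec D 0) as [HD|HD]; [unfold D in HD; lra|exfalso].
  apply Rabs_pos_lt in HD.
  (* A point [- w] with [w < q] contradicts [Hmain], as [w * (2 * B + 1) < Rabs D]; the [+ 1] keeps
     the denominator positive when [B = 0]. *)
  set (q := Rabs D / (2 * B + 1)).
  assert (Hq : 0 < q) by (apply Rdiv_lt_0_compat; lra).
  set (w := Rmin (Rmin (1 / 2) q) (Rmin (Rmin d e) h) / 2).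
  assert (Hw : 0 < Rmin (Rmin (1 / 2) q) (Rmin (Rmin d e) h))
    by (repeat apply Rmin_pos; lra).
  assert (Hw' : w < Rmin (Rmin (1 / 2) q) (Rmin (Rmin d e) h))
    by (unfold w; lra).
  assert (Hw0 : 0 < w) by (unfold w; lra).
  apply Rmin_gt in Hw' as [Hw1 Hw2].
  apply Rmin_gt in Hw1 as [Hw1 Hwq]. apply Rmin_gt in Hw2 as [Hw2 Hwh].
  apply Rmin_gt in Hw2 as [Hwd Hwe].
  assert (Hwabs : Rabs (- w) = w) by (rewrite Rabs_Ropp; apply Rabs_pos_eq; lra).
  generalize (Hmain (- w) ltac:(lra)). rewrite Hwabs.
  intros H. specialize (H Hwd Hwe Hwh).
  assert (Hlt : w * (2 * B + 1) < Rabs D).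
  { replace (Rabs D) with (q * (2 * B + 1)) by (unfold q; field; lra).
    apply Rmult_lt_compat_r; lra. }
  lra.
Qed.

(** * The recurrences of theta and Psi *)

Lemma exp_INR_mult_ln (n : nat) (q : R) : 0 < q -> exp (INR n * ln q) = q ^ n.
Proof. intros Hq. rewrite <- (Rpower_pow n q Hq). reflexivity. Qed.

Lemma Rdiv_pow (x y : R) (n : nat) : (x / y) ^ n = x ^ n / y ^ n.
Proof. unfold Rdiv. now rewrite Rpow_mult_distr, pow_inv. Qed.

Lemma gker_inv_nat (n : nat) (s : R) : (1 <= n)%nat -> 0 <= s <= 1 ->
  gker s (/ INR n) = exp (- s) * ((INR n + s) / INR n) ^ n.
Proof.
  intros Hn Hs. apply le_INR in Hn. simpl in Hn.
  assert (Hp := Rinv_0_lt_compat (INR n) ltac:(lra)).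
  assert (Hq : 1 + / INR n * s = (INR n + s) / INR n) by (field; lra).
  rewrite gker_eq by nra. rewrite Hq.
  rewrite <- exp_INR_mult_ln by (apply Rdiv_lt_0_compat; lra).
  rewrite <- exp_plus. f_equal. field. lra.
Qed.

(** The bound [2 <= n] keeps [INR n - s] positive up to [s = 1]. *)
Lemma gker_neg_inv_nat (n : nat) (s : R) : (2 <= n)%nat -> 0 <= s <= 1 ->
  gker s (- / INR n) = exp (- s) * (INR n / (INR n - s)) ^ n.
Proof.
  intros Hn Hs. apply le_INR in Hn. simpl in Hn.
  assert (Hp := Rinv_0_lt_compat (INR n) ltac:(lra)).
  assert (Hp1 : / INR n < 1) by (rewrite <- Rinv_1; apply Rinv_lt_contravar; lra).
  assert (Hq : 1 + - / INR n * s = / (INR n / (INR n - s))) by (field; lra).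
  rewrite gker_eq by nra. rewrite Hq.
  assert (Hpos : 0 < INR n / (INR n - s)) by (apply Rdiv_lt_0_compat; lra).
  rewrite ln_Rinv by exact Hpos.
  rewrite <- exp_INR_mult_ln by exact Hpos.
  rewrite <- exp_plus. f_equal. field. lra.
Qed.

(** Each new term [exp (- x) * x ^ k / k!] has as derivative the difference of the terms of index
    [k - 1] and [k], so the sum telescopes. This provides a primitive of e^(-x) x^n. *)
Lemma is_derive_exp_taylor (n : nat) (x : R) :
  is_derive (fun x => exp (- x) * sum_f_R0 (fun k => x ^ k / INR (fact k)) n) x
    (- (exp (- x) * (x ^ n / INR (fact n)))).
Proof.
  induction n as [|n IH].
  - simpl. auto_derive; [easy|]. field.
  - simpl sum_f_R0.
    apply (is_derive_ext (fun x =>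
      exp (- x) * sum_f_R0 (fun k => x ^ k / INR (fact k)) n
      + exp (- x) * (x ^ S n / INR (fact (S n))))).
    { intros t. symmetry. apply Rmult_plus_distr_l. }
    replace (- (exp (- x) * (x ^ S n / INR (fact (S n)))))
      with (plus (- (exp (- x) * (x ^ n / INR (fact n))))
              (exp (- x) * (x ^ n / INR (fact n))
               - exp (- x) * (x ^ S n / INR (fact (S n)))))
      by (unfold plus; simpl; ring).
    apply (is_derive_plus (V := R_NormedModule)); [exact IH|].
    rewrite fact_simpl, mult_INR.
    assert (H1 := INR_fact_neq_0 n). assert (H2 := not_0_INR (S n) ltac:(easy)).
    (* Differentiating [x ^ N] produces the exponent [Nat.pred N]; with [n] written this way,
       [field] recognises the same power on both sides. *)
    assert (Hn : n = Nat.pred (S n)) by easy. revert Hn H2.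
    revert H1. generalize (S n) as N, (INR (fact n)) as c.
    intros N c Hc -> HN. auto_derive; [easy|].
    field. split; assumption.
Qed.

(** Telescoping again: the term of index [k] contributes e^x (k!/x^(k+1) - (k+1)!/x^(k+2)). The sum
    is the expansion of Ei obtained by repeated integration by parts. *)
Lemma is_derive_Ei_asymptotic (n : nat) (x : R) : 0 < x ->
  is_derive
    (fun x => exp x * sum_f_R0 (fun k => INR (fact k) / x ^ S k) n) x
    (exp x / x - exp x * (INR (fact (S n)) / x ^ S (S n))).
Proof.
  intros Hx. induction n as [|n IH].
  - simpl. auto_derive; [lra|]. field. lra.
  - simpl sum_f_R0.
    apply (is_derive_ext (fun x =>
      exp x * sum_f_R0 (fun k => INR (fact k) / x ^ S k) n
      + exp x * (INR (fact (S n)) / x ^ S (S n)))).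
    { intros t. symmetry. apply Rmult_plus_distr_l. }
    replace (exp x / x - exp x * (INR (fact (S (S n))) / x ^ S (S (S n))))
      with (plus (exp x / x - exp x * (INR (fact (S n)) / x ^ S (S n)))
              (exp x * (INR (fact (S n)) / x ^ S (S n))
               - exp x * (INR (fact (S (S n))) / x ^ S (S (S n)))))
      by (unfold plus; simpl; ring).
    apply (is_derive_plus (V := R_NormedModule)); [exact IH|].
    assert (H0 := pow_nonzero x n ltac:(lra)).
    rewrite (fact_simpl (S n)), mult_INR.
    generalize (INR (fact (S n))) as c. intros c.
    assert (Hn : S n = Nat.pred (S (S n))) by easy.
    change (x ^ S (S (S n))) with (x * x ^ S (S n)).
    assert (H1 := pow_nonzero x (S (S n)) ltac:(lra)).
    assert (H2 : x ^ S (S n) = x * x ^ S n) by easy.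
    revert Hn H1 H2. generalize (S (S n)) as N. intros N Hn H1 H2.
    auto_derive; [exact H1|]. rewrite <- Hn, H2.
    rewrite H2 in H1. field. split; intros E; apply H1; rewrite E; ring.
Qed.

(** Substitute [x = n + s] in the integral of e^(-x) x^n / n! over [n, n+1]. At both ends the term
    e^x / 2 of the definition is multiplied by e^(-x), and the two halves cancel. *)
Lemma theta_recurrence (n : nat) (t t' : R) :
  (1 <= n)%nat -> is_theta n t -> is_theta (S n) t' ->
  t' * gker 1 (/ INR n) - t + 1 - gint (/ INR n) = 0.
Proof.
  intros Hn Ht Ht'.
  assert (HN : 1 <= INR n) by (apply (le_INR 1 n) in Hn; exact Hn).
  assert (Hf := INR_fact_neq_0 n).
  assert (Hpn := pow_nonzero (INR n) n ltac:(lra)).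
  set (p := fun x => sum_f_R0 (fun k => x ^ k / INR (fact k)) n).
  (* This factor normalises the integrand to the value 1 at [s = 0], as for the kernel. *)
  set (c := INR (fact n) / INR n ^ n * exp (INR n)).
  assert (Hint : gint (/ INR n)
    = c * (exp (- INR n) * p (INR n))
      - c * (exp (- (INR n + 1)) * p (INR n + 1))).
  { replace (c * (exp (- INR n) * p (INR n))
      - c * (exp (- (INR n + 1)) * p (INR n + 1)))
      with (minus (- (c * (exp (- (INR n + 1)) * p (INR n + 1))))
                  (- (c * (exp (- (INR n + 0)) * p (INR n + 0)))))
      by (rewrite Rplus_0_r; unfold minus, plus, opp; simpl; ring).
    apply is_RInt_unique.
    apply (is_RInt_derive (V := R_CompleteNormedModule)
      (fun s => - (c * (exp (- (INR n + s)) * p (INR n + s))))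
      (fun s => gker s (/ INR n))).
    - intros s. rewrite Rmin_left, Rmax_right by lra. intros Hs.
      rewrite (gker_inv_nat n s Hn Hs).
      assert (Hd : is_derive (fun s => exp (- (INR n + s)) * p (INR n + s)) s
        (scal 1 (- (exp (- (INR n + s)) * ((INR n + s) ^ n / INR (fact n)))))).
      { apply (is_derive_comp (V := R_NormedModule)
          (fun x => exp (- x) * p x) (fun s => INR n + s)).
        - apply is_derive_exp_taylor.
        - auto_derive; [easy|ring]. }
      replace (exp (- s) * ((INR n + s) / INR n) ^ n)
        with (opp (c * (scal 1
          (- (exp (- (INR n + s)) * ((INR n + s) ^ n / INR (fact n))))))).
      + apply (is_derive_opp (V := R_NormedModule)
          (fun s => c * (exp (- (INR n + s)) * p (INR n + s)))).
        now apply is_derive_scal.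
      + unfold opp, scal; simpl; unfold mult; simpl. unfold c.
        rewrite Rdiv_pow.
        replace (exp (- s)) with (exp (INR n) * exp (- (INR n + s)))
          by (rewrite <- exp_plus; f_equal; ring).
        field. split; assumption.
    - intros s. rewrite Rmin_left, Rmax_right by lra. intros Hs.
      assert (Hz := Rinv_0_lt_compat (INR n) ltac:(lra)).
      apply continuous_gker; [exact Hs|lra..]. }
  rewrite Hint, (gker_inv_nat n 1 Hn) by lra.
  unfold is_theta in Ht, Ht'.
  replace (S n - 1)%nat with n in Ht' by lia. rewrite S_INR in Ht'.
  assert (Hpn1 : p (INR n) = exp (INR n) / 2
    - INR n ^ n / INR (fact n) * t + INR n ^ n / INR (fact n)).
  (* [p] has one term more than the sum in [is_theta n]; this term is the source of the [+ 1] in the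
     recurrence. It has exactly the terms of the sum in [is_theta (S n)]. *)
  { unfold p. destruct n as [|k]; [lia|].
    replace (S k - 1)%nat with k in Ht by lia. rewrite tech5. lra. }
  fold (p (INR n + 1)) in Ht'.
  assert (Hpn2 : p (INR n + 1)
    = exp (INR n + 1) / 2 - (INR n + 1) ^ n / INR (fact n) * t').
  { replace ((INR n + 1) ^ n / INR (fact n))
      with ((INR n + 1) ^ S n / INR (fact (S n))); [lra|].
    rewrite fact_simpl, mult_INR, S_INR. simpl pow. field.
    split; [exact Hf|lra]. }
  rewrite Hpn1, Hpn2. unfold c.
  rewrite Rdiv_pow.
  rewrite Ropp_plus_distr, !exp_plus, !exp_Ropp.
  assert (He1 := exp_pos 1). assert (HeN := exp_pos (INR n)).
  field. repeat split; lra || assumption.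
Qed.

(** * Ei up to an additive constant, and the recurrence of Psi *)

Lemma continuous_exp_div (t : R) : t <> 0 -> continuous (fun t => exp t / t) t.
Proof.
  intros Ht. apply (ex_derive_continuous (V := R_NormedModule)).
  now auto_derive.
Qed.

Lemma ex_RInt_exp_div (a b : R) : 0 < a * b -> ex_RInt (fun t => exp t / t) a b.
Proof.
  intros Hab. apply (ex_RInt_continuous (V := R_CompleteNormedModule)).
  intros t Ht. apply continuous_exp_div. intros ->.
  destruct (Rle_dec a b).
  - rewrite Rmin_left, Rmax_right in Ht by lra. nra.
  - rewrite Rmin_right, Rmax_left in Ht by lra. nra.
Qed.

Lemma RInt_exp_div_tail (a b : R) : a <= b <= -1 ->
  Rabs (RInt (fun t => exp t / t) a b) <= exp b.
Proof.
  intros Hab.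
  assert (Hex : ex_RInt (fun t => exp t / t) a b)
    by (apply ex_RInt_exp_div; nra).
  assert (He : is_RInt exp a b (exp b - exp a)).
  { apply (is_RInt_derive (V := R_CompleteNormedModule) exp exp).
    - intros; apply is_derive_exp.
    - intros; apply continuous_exp. }
  apply Rle_trans with (exp b - exp a); [|generalize (exp_pos a); lra].
  apply (norm_RInt_le (V := R_NormedModule) (fun t => exp t / t) exp a b
           (RInt (fun t => exp t / t) a b) (exp b - exp a)).
  - lra.
  - intros t Ht. unfold norm; simpl; unfold abs; simpl.
    unfold Rdiv. rewrite Rabs_mult, Rabs_pos_eq, Rabs_inv, Rabs_left
      by (try lra; left; apply exp_pos).
    rewrite <- (Rmult_1_r (exp t)) at 2.
    apply Rmult_le_compat_l; [left; apply exp_pos|].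
    rewrite <- Rinv_1. apply Rinv_le_contravar; lra.
  - now apply (RInt_correct (V := R_CompleteNormedModule)).
  - exact He.
Qed.

(** Cauchy's criterion: for [u <= v <= -1] the integral over [u, v] is at most [exp v] in absolute
    value, which is below [eps] once [v < ln eps]. *)
Lemma ex_RInt_gen_exp_div : exists l : R,
  is_RInt_gen (fun t => exp t / t) (Rbar_locally m_infty) (at_point (-1)) l.
Proof.
  destruct (proj1 (filterlim_locally_cauchy (U := R_CompleteSpace)
    (F := Rbar_locally m_infty)
    (fun a => RInt (fun t => exp t / t) a (-1)))) as [l Hl].
  - intros eps.
    exists (fun a => a < Rmin (-1) (ln eps)).
    split; [now exists (Rmin (-1) (ln eps))|].
    assert (Hle : forall u v, u <= v -> v < Rmin (-1) (ln eps) ->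
      Rabs (RInt (fun t => exp t / t) u (-1)
            - RInt (fun t => exp t / t) v (-1)) < eps).
    { intros u v Huv Hv. apply Rmin_gt in Hv as [Hv1 Hv2].
      assert (Hch := RInt_Chasles (V := R_CompleteNormedModule)
        (fun t => exp t / t) u v (-1)
        ltac:(apply ex_RInt_exp_div; nra) ltac:(apply ex_RInt_exp_div; nra)).
      unfold plus in Hch; simpl in Hch.
      replace (RInt (fun t => exp t / t) u (-1)
            - RInt (fun t => exp t / t) v (-1))
        with (RInt (fun t => exp t / t) u v) by lra.
      eapply Rle_lt_trans; [apply RInt_exp_div_tail; lra|].
      rewrite <- (exp_ln eps) by apply cond_pos. now apply exp_increasing. }
    intros u v Hu Hv. destruct (Rle_dec u v).
    + apply ball_sym. now apply Hle.
    + apply Hle; [lra|exact Hu].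
  - exists l. intros P HP.
    apply Filter_prod with (fun a => a < -1 /\ P (RInt (fun t => exp t / t) a (-1)))
      (fun b => b = -1).
    + apply filter_and; [now exists (-1)|]. now apply Hl.
    + easy.
    + intros a b [Ha HPa] ->. simpl. eexists. split; [|exact HPa].
      apply (RInt_correct (V := R_CompleteNormedModule)).
      apply ex_RInt_exp_div. nra.
Qed.

(* [2 * sinh t / t], continuously extended at 0. *)
Definition sinhc (t : R) : R :=
  if Req_EM_T t 0 then 2 else (exp t - exp (- t)) / t.

(** At 0 this is differentiability: [sinhc] is the difference quotient at 0 of [exp t - exp (- t)],
    whose derivative there is 2. *)
Lemma continuous_sinhc (t : R) : continuous sinhc t.
Proof.
  destruct (Req_dec t 0) as [->|Ht].
  - assert (Hd : is_derive (fun t => exp t - exp (- t)) 0 2).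
    { auto_derive; [easy|]. rewrite Ropp_0, exp_0. ring. }
    apply is_derive_Reals in Hd.
    apply continuity_pt_filterlim. intros eps Heps.
    destruct (Hd eps Heps) as [d Hd'].
    exists d. split; [apply cond_pos|].
    intros x [[_ Hx0] Hx]. simpl in *. unfold R_dist in *.
    unfold sinhc. destruct (Req_EM_T 0 0) as [_|]; [|easy].
    destruct (Req_EM_T x 0) as [|Hx1]; [congruence|].
    rewrite Rminus_0_r in Hx.
    specialize (Hd' x Hx1 Hx).
    rewrite Rplus_0_l, Ropp_0, Rminus_diag, Rminus_0_r in Hd'. exact Hd'.
  - apply continuous_ext_loc with (fun t => (exp t - exp (- t)) / t).
    + assert (H := open_neq 0 t Ht).
      revert H. apply filter_imp. intros x Hx.
      unfold sinhc. now destruct (Req_EM_T x 0).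
    + apply (ex_derive_continuous (V := R_NormedModule)). now auto_derive.
Qed.

(** Reflecting [-1, -eps] onto [eps, 1] cancels the two singularities 1/t against each other, so
    [eps] survives only as the endpoint of an integral of a continuous function. *)
Lemma Ei_cut_eq (x eps l : R) : 0 < x -> 0 < eps < 1 ->
  is_RInt_gen (fun t => exp t / t) (Rbar_locally m_infty) (at_point (-1)) l ->
  Ei_cut x eps = l + RInt (fun t => exp t / t) 1 x + RInt sinhc eps 1.
Proof.
  intros Hx He Hl. unfold Ei_cut.
  replace (RInt_gen (fun t => exp t / t) (Rbar_locally m_infty) (at_point (- eps)))
    with (l + RInt (fun t => exp t / t) (-1) (- eps)).
  2:{ symmetry. apply is_RInt_gen_unique.
      apply (is_RInt_gen_Chasles (V := R_NormedModule)) with (-1); [exact Hl|].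
      apply is_RInt_gen_at_point.
      apply (RInt_correct (V := R_CompleteNormedModule)).
      apply ex_RInt_exp_div. nra. }
  assert (Hex : ex_RInt (fun t => exp t / t) eps 1)
    by (apply ex_RInt_exp_div; lra).
  assert (Hexn : ex_RInt (fun t => exp (- t) / t) eps 1).
  { apply (ex_RInt_continuous (V := R_CompleteNormedModule)).
    intros t. rewrite Rmin_left, Rmax_right by lra. intros Ht.
    apply (ex_derive_continuous (V := R_NormedModule)). auto_derive. lra. }
  assert (Hneg : RInt (fun t => exp t / t) (-1) (- eps)
                 = - RInt (fun t => exp (- t) / t) eps 1).
  { assert (Hsub : is_RInt (fun t => opp (exp (- t) / - t)) 1 eps
                     (RInt (fun t => exp t / t) (-1) (- eps))).
    { apply (is_RInt_comp_opp (V := R_NormedModule) (fun t => exp t / t)).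
      apply (RInt_correct (V := R_CompleteNormedModule)).
      apply ex_RInt_exp_div. lra. }
    assert (Hsw : is_RInt (fun t => exp (- t) / t) 1 eps
                    (opp (RInt (fun t => exp (- t) / t) eps 1))).
    { apply (is_RInt_swap (V := R_NormedModule)).
      now apply (RInt_correct (V := R_CompleteNormedModule)). }
    rewrite <- (is_RInt_unique _ _ _ _ Hsub).
    apply is_RInt_unique. apply is_RInt_ext with (2 := Hsw).
    intros t. rewrite Rmin_right, Rmax_left by lra. intros Ht.
    unfold opp; simpl. field. lra. }
  assert (Hs : RInt sinhc eps 1 = RInt (fun t => exp t / t) eps 1
                                  - RInt (fun t => exp (- t) / t) eps 1).
  { transitivity (RInt (fun t => minus (exp t / t) (exp (- t) / t)) eps 1).
    - apply RInt_ext. intros t. rewrite Rmin_left, Rmax_right by lra. intros Ht.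
      unfold sinhc. destruct (Req_EM_T t 0); [lra|].
      unfold minus, plus, opp; simpl. field. lra.
    - now apply (RInt_minus (V := R_CompleteNormedModule)). }
  assert (Hch := RInt_Chasles (V := R_CompleteNormedModule)
    (fun t => exp t / t) eps 1 x Hex ltac:(apply ex_RInt_exp_div; lra)).
  unfold plus in Hch; simpl in Hch. lra.
Qed.

Definition exp_div_primitive (x : R) : R := RInt (fun t => exp t / t) 1 x.

(** The limit exists, so [iota] returns it. The constant collects the tail up to -1 and the folded
    middle part; it cancels between two consecutive integers. *)
Lemma Ei_eq : exists c, forall x, 0 < x -> Ei x = c + exp_div_primitive x.
Proof.
  destruct ex_RInt_gen_exp_div as [l Hl].
  exists (l + RInt sinhc 0 1). intros x Hx. unfold exp_div_primitive.
  apply (iota_filterlim_locally (V := R_CompleteNormedModule)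
           (F := at_right 0) (Ei_cut x)).
  apply filterlim_ext_loc with
    (fun eps => l + RInt (fun t => exp t / t) 1 x + RInt sinhc eps 1).
  - exists (mkposreal 1 Rlt_0_1). intros y Hy Hy0.
    symmetry. apply Ei_cut_eq; [exact Hx| |exact Hl].
    apply Rabs_def2 in Hy. unfold minus, plus, opp in Hy; simpl in Hy. lra.
  - replace (l + RInt sinhc 0 1 + RInt (fun t => exp t / t) 1 x)
      with (l + RInt (fun t => exp t / t) 1 x + RInt sinhc 0 1) by ring.
    apply (filterlim_filter_le_1 (F := locally 0));
      [apply filter_le_within; apply locally_filter|].
    apply (continuous_plus (V := R_NormedModule)
             (fun _ => l + RInt (fun t => exp t / t) 1 x)
             (fun eps => RInt sinhc eps 1)); [apply continuous_const|].
    (* The integral is differentiable in its lower endpoint, hence continuous at [eps = 0]. *)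
    apply (ex_derive_continuous (V := R_NormedModule)).
    eexists. apply (is_derive_RInt' (V := R_NormedModule) sinhc _ 0 1).
    + apply filter_forall. intros e.
      apply (RInt_correct (V := R_CompleteNormedModule)).
      apply (ex_RInt_continuous (V := R_CompleteNormedModule)).
      intros; apply continuous_sinhc.
    + apply continuous_sinhc.
Qed.

(** With N = n + 1, substitute [x = N - s] in the integral of e^x n! / x^(n+1) over [n, N]. The
    integrand is the derivative of Ei minus its n-term asymptotic sum, and that difference is
    expressed through [p] at n and through [p'] at N. *)
Lemma Psi_recurrence (n : nat) (p p' : R) :
  (1 <= n)%nat -> is_Psi n p -> is_Psi (S n) p' ->
  - p * gker 1 (- / INR (S n)) - - p' + 1 - gint (- / INR (S n)) = 0.
Proof.
  intros Hn Hp Hp'.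
  destruct Ei_eq as [c Hc].
  destruct n as [|k]; [lia|]. clear Hn.
  set (n := S k) in *.
  assert (HN : 1 <= INR n) by (apply (le_INR 1 n); lia).
  set (A := fun x => exp x * sum_f_R0 (fun k => INR (fact k) / x ^ S k) k).
  set (P := exp_div_primitive).
  assert (HP : forall x, 0 < x -> is_derive P x (exp x / x)).
  { intros x Hx. apply (is_derive_RInt (V := R_NormedModule)
      (fun t => exp t / t) P 1 x).
    - exists (mkposreal x Hx). intros y Hy.
      apply (RInt_correct (V := R_CompleteNormedModule)), ex_RInt_exp_div.
      apply Rabs_def2 in Hy. unfold minus, plus, opp in Hy; simpl in Hy. lra.
    - apply continuous_exp_div. lra. }
  assert (Hder : forall x, 0 < x ->
    is_derive (fun x => P x - A x) x (exp x * (INR (fact n) / x ^ S n))).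
  { intros x Hx.
    replace (exp x * (INR (fact n) / x ^ S n))
      with (minus (exp x / x) (exp x / x - exp x * (INR (fact n) / x ^ S n)))
      by (unfold minus, plus, opp; simpl; ring).
    apply (is_derive_minus (V := R_NormedModule) P A); [now apply HP|].
    now apply is_derive_Ei_asymptotic. }
  set (N := INR (S n)).
  assert (HNn : N = INR n + 1) by apply S_INR.
  assert (Hf := INR_fact_neq_0 n).
  assert (Hk : forall s, 0 <= s <= 1 ->
    gker s (- / N) = exp (- s) * (N / (N - s)) ^ S n)
    by (intros s Hs; apply gker_neg_inv_nat; [lia|exact Hs]).
  set (w := exp (- N) * N ^ S n / INR (fact n)).
  assert (Hint : gint (- / N)
    = w * ((P N - A N) - (P (INR n) - A (INR n)))).
  { replace (w * ((P N - A N) - (P (INR n) - A (INR n))))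
      with (minus (- (w * (P (N - 1) - A (N - 1))))
                  (- (w * (P (N - 0) - A (N - 0)))))
      by (rewrite Rminus_0_r; replace (N - 1) with (INR n) by lra;
          unfold minus, plus, opp; simpl; ring).
    apply is_RInt_unique.
    apply (is_RInt_derive (V := R_CompleteNormedModule)
      (fun s => - (w * (P (N - s) - A (N - s))))
      (fun s => gker s (- / N))).
    - intros s. rewrite Rmin_left, Rmax_right by lra. intros Hs.
      rewrite (Hk s Hs).
      assert (Hd : is_derive (fun s => P (N - s) - A (N - s)) s
        (scal (-1) (exp (N - s) * (INR (fact n) / (N - s) ^ S n)))).
      { apply (is_derive_comp (V := R_NormedModule)
          (fun x => P x - A x) (fun s => N - s)).
        - apply Hder. lra.
        - auto_derive; [easy|ring]. }
      replace (exp (- s) * (N / (N - s)) ^ S n)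
        with (opp (w * (scal (-1)
          (exp (N - s) * (INR (fact n) / (N - s) ^ S n))))).
      + apply (is_derive_opp (V := R_NormedModule)
          (fun s => w * (P (N - s) - A (N - s)))).
        now apply is_derive_scal.
      + change (- (w * (-1 * (exp (N - s) * (INR (fact n) / (N - s) ^ S n))))
          = exp (- s) * (N / (N - s)) ^ S n). unfold w.
        rewrite Rdiv_pow.
        replace (exp (- s)) with (exp (- N) * exp (N - s))
          by (rewrite <- exp_plus; f_equal; ring).
        assert (Hpow := pow_nonzero (N - s) (S n) ltac:(lra)).
        field. split; assumption.
    - intros s. rewrite Rmin_left, Rmax_right by lra. intros Hs.
      assert (Hz := Rinv_0_lt_compat N ltac:(lra)).
      assert (/ N < 1) by (rewrite <- Rinv_1; apply Rinv_lt_contravar; lra).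
      apply continuous_gker; [exact Hs|lra..]. }
  assert (HA : forall x, x <> 0 ->
    A x = exp x / x * sum_f_R0 (fun k => INR (fact k) / x ^ k) k).
  { intros x Hx. unfold A, Rdiv. rewrite Rmult_assoc. f_equal.
    rewrite scal_sum. apply sum_eq. intros i _. simpl pow.
    rewrite Rinv_mult. ring. }
  rewrite Hint, (Hk 1) by lra. replace (N - 1) with (INR n) by lra.
  unfold is_Psi in Hp, Hp'.
  replace (n - 1)%nat with k in Hp by lia.
  replace (S n - 1)%nat with (S k) in Hp' by lia. rewrite tech5 in Hp'.
  fold n N in Hp'. rewrite Hc in Hp, Hp' by lra.
  fold P in Hp, Hp'.
  rewrite !HA by lra.
  assert (Hpn := pow_nonzero (INR n) n ltac:(lra)).
  assert (HpN := pow_nonzero N n ltac:(lra)).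
  assert (He1 := exp_pos (INR n)). assert (He2 := exp_pos N).
  set (s1 := sum_f_R0 (fun k => INR (fact k) / INR n ^ k) k) in *.
  set (s2 := sum_f_R0 (fun k => INR (fact k) / N ^ k) k) in *.
  assert (HP1 : P (INR n) = exp (INR n) / INR n
    * (s1 + INR (fact n) / INR n ^ n * p) - c).
  { rewrite Hp. field. lra. }
  (* The sum in [is_Psi (S n)] has one term more than [A], namely [n! / N ^ n]; it has the same
     coefficient as [p'], whence the [+ 1] in the recurrence. *)
  assert (HP2 : P N = exp N / N
    * (s2 + INR (fact n) / N ^ n + INR (fact n) / N ^ n * p') - c).
  { rewrite fact_simpl, mult_INR in Hp'. fold N in Hp'.
    replace (N * INR (fact n) / N ^ S n) with (INR (fact n) / N ^ n) in Hp'
      by (change (N ^ S n) with (N * N ^ n); field; lra).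
    rewrite Hp'. field. lra. }
  rewrite HP1, HP2. unfold w. rewrite Rdiv_pow.
  replace (exp (- (1))) with (exp (INR n) * exp (- N))
    by (rewrite <- exp_plus; f_equal; lra).
  rewrite exp_Ropp. change (N ^ S n) with (N * N ^ n).
  change (INR n ^ S n) with (INR n * INR n ^ n).
  field. repeat split; lra || assumption.
Qed.

(** * Comparison of the coefficients *)

Lemma partial_inv (a : nat -> R) (m : nat) (x : R) :
  partial a m (/ x) = sum_f_R0 (fun r => a r / x ^ r) (m - 1).
Proof.
  apply sum_eq. intros r _. now rewrite pow_inv.
Qed.

Lemma partial_neg_inv (a : nat -> R) (m : nat) (x : R) :
  partial (fun r => (-1) ^ (r + 1) * a r) m (- / x)
  = - sum_f_R0 (fun r => a r / x ^ r) (m - 1).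
Proof.
  rewrite <- (Ropp_involutive (partial _ _ _)). f_equal.
  replace (- partial (fun r => (-1) ^ (r + 1) * a r) m (- / x))
    with (-1 * partial (fun r => (-1) ^ (r + 1) * a r) m (- / x)) by ring.
  unfold partial. rewrite scal_sum. apply sum_eq. intros r _.
  replace (- / x) with (-1 * / x) by ring.
  rewrite Rpow_mult_distr, pow_inv, pow_add.
  transitivity (a r / x ^ r * ((-1) ^ r * (-1) ^ r)); [simpl; unfold Rdiv; ring|].
  rewrite <- Rpow_mult_distr. replace (-1 * -1) with 1 by ring.
  rewrite pow1. ring.
Qed.

Lemma is_lim_seq_inv_INR_S : is_lim_seq (fun n => / INR (S n)) 0.
Proof.
  apply (is_lim_seq_incr_1 (fun n => / INR n)).
  apply (is_lim_seq_inv INR p_infty); [apply is_lim_seq_INR|easy].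
Qed.

(** A recurrence links two consecutive indices, but both errors must be measured in powers of a
    single [z]. The factor [2 ^ m] comes from [k <= j + 1 <= 2 * j]. *)
Lemma asymptotic_expansion_neighbours (u a : nat -> R) (m : nat) :
  asymptotic_expansion u a -> (1 <= m)%nat ->
  exists C, eventually (fun n => forall j k,
    (S n <= j <= S (S n))%nat -> (S n <= k <= S (S n))%nat ->
    Rabs (u j - sum_f_R0 (fun r => a r / INR j ^ r) (m - 1))
      <= C * Rabs (/ INR k) ^ m).
Proof.
  intros Hu Hm. destruct (Hu m Hm) as [C [N HN]].
  exists (Rabs C * 2 ^ m), N. intros n Hn j k Hj Hk.
  eapply Rle_trans; [apply HN; lia|].
  assert (Hj1 : 1 <= INR j) by (apply (le_INR 1); lia).
  assert (Hk1 : 1 <= INR k) by (apply (le_INR 1); lia).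
  assert (Hkj : INR k <= INR j + 1) by (rewrite <- S_INR; apply le_INR; lia).
  rewrite (Rabs_pos_eq (/ INR k)) by (left; apply Rinv_0_lt_compat; lra).
  rewrite Rmult_assoc, <- Rpow_mult_distr.
  apply Rle_trans with (Rabs C * (/ INR j) ^ m).
  - unfold Rdiv. rewrite pow_inv. apply Rmult_le_compat_r; [|apply Rle_abs].
    left. apply Rinv_0_lt_compat, pow_lt. lra.
  - apply Rmult_le_compat_l; [apply Rabs_pos|]. apply pow_incr.
    split; [left; apply Rinv_0_lt_compat; lra|].
    apply Rmult_le_reg_r with (INR j * INR k); [nra|].
    replace (/ INR j * (INR j * INR k)) with (INR k) by (field; lra).
    replace (2 * / INR k * (INR j * INR k)) with (2 * INR j) by (field; lra).
    lra.
Qed.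

Theorem theorem1p1 (theta Psi rho psi : nat -> R)
  (theta_def : forall n : nat, (1 <= n)%nat -> is_theta n (theta n))
  (Psi_def : forall n : nat, (1 <= n)%nat -> is_Psi n (Psi n))
  (theta_exp : asymptotic_expansion theta rho)
  (Psi_exp : asymptotic_expansion Psi psi) :
  forall r : nat, psi r = (-1) ^ (r + 1) * rho r.
Proof.
  (* The sign rule is an involution; in this direction both sides are coefficients of formal
     solutions of the same equation. *)
  assert (H : forall r, rho r = (-1) ^ (r + 1) * psi r).
  { apply (residual_unique rho (fun r => (-1) ^ (r + 1) * psi r)).
    - intros m Hm.
      destruct (asymptotic_expansion_neighbours _ _ m theta_exp Hm) as [C HC].
      apply (residual_bigO rho (fun n => theta (S n)) (fun n => theta (S (S n)))
               (fun n => / INR (S n)) m C).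
      + apply is_lim_seq_inv_INR_S.
      + intros n. apply Rinv_neq_0_compat, not_0_INR. easy.
      + intros n. apply theta_recurrence; [lia|apply theta_def..]; lia.
      + revert HC. apply filter_imp. intros n H.
        rewrite partial_inv. apply H; lia.
      + revert HC. apply filter_imp. intros n H.
        replace (/ INR (S n) * / (1 + / INR (S n))) with (/ INR (S (S n))).
        * rewrite partial_inv. apply H; lia.
        * rewrite (S_INR (S n)). assert (Hn := pos_INR (S n)).
          field. repeat split; try lra; apply not_0_INR; easy.
    - intros m Hm.
      destruct (asymptotic_expansion_neighbours _ _ m Psi_exp Hm) as [C HC].
      (* On negative points [z / (1 + z)] lowers the index, so the sequence with the larger index
         takes the place of [x]; the shift by 2 makes both indices at least 1. *)
      apply (residual_bigO _ (fun n => - Psi (S (S n))) (fun n => - Psi (S n))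
               (fun n => - / INR (S (S n))) m C).
      + replace (Finite 0) with (Rbar_opp (Finite 0)) by (simpl; f_equal; ring).
        apply -> is_lim_seq_opp.
        apply (is_lim_seq_incr_1 (fun n => / INR (S n))), is_lim_seq_inv_INR_S.
      + intros n. apply Ropp_neq_0_compat, Rinv_neq_0_compat, not_0_INR. easy.
      + intros n. apply Psi_recurrence; [lia|apply Psi_def..]; lia.
      + revert HC. apply filter_imp. intros n H.
        rewrite partial_neg_inv, Rabs_Ropp.
        unfold Rminus. rewrite <- Ropp_plus_distr, Rabs_Ropp. apply H; lia.
      + revert HC. apply filter_imp. intros n H.
        replace (- / INR (S (S n)) * / (1 + - / INR (S (S n))))
          with (- / INR (S n)).
        * rewrite partial_neg_inv, Rabs_Ropp.
          unfold Rminus. rewrite <- Ropp_plus_distr, Rabs_Ropp. apply H; lia.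
        * rewrite (S_INR (S n)). assert (Hn := pos_INR (S n)).
          assert (INR (S n) <> 0) by (apply not_0_INR; easy).
          field. repeat split; lra. }
  intros r. rewrite H, <- Rmult_assoc, <- Rpow_mult_distr.
  replace (-1 * -1) with 1 by ring. rewrite pow1. ring.
Qed.
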